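(* Consider the Nested Logit model with outside option described in the context. For each $S \in \mathcal{S} \cup \{[n]\}$, suppose $m$ independent choices are sampled from the distribution $\phi(\cdot, S)$ on $S \cup \{0\}$ (independently across assortments), and let $\hat\phi(i,S)$ be the empirical frequency with which $i \in S \cup \{0\}$ is chosen among these $m$ samples. Let $\rho, \Delta, \delta \in (0,1)$ be such that $\phi(i,[n]) \ge \rho$ for all $i \in [n] \cup \{0\}$ and $\left|\frac{\phi(i,S)}{\phi(i,S)+\phi(j,S)} - \frac{\phi(i,[n])}{\phi(i,[n])+\phi(j,[n])}\right| \ge \Delta$ for all $S \in \mathcal{S}$ and $i,j \in S \cup \{0\}$ with $\mathsf{BF}(i,S) \neq \mathsf{BF}(j,S)$. Let $K = (|\mathcal{S}|+1)\left(n+1+\binom{n+1}{2}\right)$. There is an absolute numerical constant $C$ such that, if $m \ge 3C^2 \frac{\log(2K/\delta)}{\rho \Delta^2}$, then with probability at least $1-\delta$, for all $S \in \mathcal{S}$ and all $i,j \in S \cup \{0\}$: $|z(i \succ j, S)| \le 8\sqrt{3\log(2K/\delta)}$ if and only if $\mathsf{BF}(i,S) = \mathsf{BF}(j,S)$.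
   Context: Items: $[n]=\{1,\dots,n\}$ with $n\ge 2$. Experiment design: fix an integer base $b \ge 2$, let $L = \lceil \log_b n \rceil$, fix an injective map $\sigma: [n] \to \{0,\dots,b-1\}^L$ with coordinates $\sigma_\ell(i)$, let $S_{\ell,-d} = \{i \in [n] : \sigma_\ell(i) \neq d\}$ for $\ell \in \{1,\dots,L\}$, $d \in \{0,\dots,b-1\}$, and $\mathcal{S} = \{S_{\ell,-d}\}_{\ell,d}$; the control assortment $[n]$ is also offered. Nested Logit model with outside option: $\mathcal{N}$ is a partition of $[n]$ into nests, $N(i)$ the nest containing $i$; weights $v_i > 0$; parameters $\lambda_N \in [0,1]$, with an extra weight $v_N>0$ when $\lambda_N=0$. $v_N(S) = (\sum_{i \in N \cap S} v_i)^{\lambda_N}$ if $\lambda_N \in (0,1]$, $v_N(S) = v_N \mathbf{1}(N \cap S \neq \emptyset)$ if $\lambda_N = 0$. For $i \in S$, $\phi(i,S) = \frac{v_{N(i)}(S)}{1 + \sum_{N} v_N(S)} \cdot \frac{v_i}{\sum_{j \in N(i) \cap S} v_j}$, and $\phi(0,S) = \frac{1}{1 + \sum_{N} v_N(S)}$. Boost factor: $\mathsf{BF}(i,S) = \phi(i,S)/\phi(i,[n])$ for $i \in S \cup \{0\}$. Test statistic: writing $a = \hat\phi(i,S)$, $c = \hat\phi(j,S)$, $a' = \hat\phi(i,[n])$, $c' = \hat\phi(j,[n])$, $z(i \succ j, S) = \dfrac{\frac{a}{a+c} - \frac{a'}{a'+c'}}{\sqrt{\frac{a+a'}{a+c+a'+c'}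 \cdot \frac{c+c'}{a+c+a'+c'} \cdot \left(\frac{1/m}{a+c} + \frac{1/m}{a'+c'}\right)}}$. *)

(* Defs.v *)
From HB Require Import structures.
From mathcomp Require Import all_boot all_order all_algebra.
From mathcomp Require Import reals exp.
Set Implicit Arguments. Unset Strict Implicit. Unset Printing Implicit Defensive.
Import Order.TTheory GRing.Theory Num.Theory.
Local Open Scope ring_scope.

(* Items [n] = {1..n} are represented by 'I_n (item k+1 <-> k : 'I_n);
   options are [option 'I_n], with [None] the outside option 0. *)
Definition opt_in (n : nat) (S : {set 'I_n}) (o : option 'I_n) : bool :=
  if o is Some i then i \in S else true.

Section NestedLogit.
Variables (R : realType) (n : nat).
(* P : the partition of [n] into nests; v : item weights;
   lam N = lambda_N; vN N = extra nest weight (used only when lam N = 0). *)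
Variables (P : {set {set 'I_n}}) (v : 'I_n -> R) (lam vN : {set 'I_n} -> R).

Definition nest_weight (N S : {set 'I_n}) : R :=
  if 0 < lam N then (\sum_(i in N :&: S) v i) `^ (lam N)
  else vN N * (N :&: S != set0)%:R.

Definition nl_denom (S : {set 'I_n}) : R := 1 + \sum_(N in P) nest_weight N S.

Definition nl_phi (S : {set 'I_n}) (o : option 'I_n) : R :=
  match o with
  | None => 1 / nl_denom S
  | Some i => if i \in S then
      nest_weight (pblock P i) S / nl_denom S *
        (v i / \sum_(j in pblock P i :&: S) v j)
    else 0
  end.

Definition nl_BF (S : {set 'I_n}) (o : option 'I_n) : R :=
  nl_phi S o / nl_phi [set: 'I_n] o.
End NestedLogit.

(* Experiment design: L = ceil(log_b n) = up_log b n, sigma : [n] -> {0..b-1}^L. *)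
Definition design_set (n b : nat) (sigma : 'I_n -> {ffun 'I_(up_log b n) -> 'I_b})
  (l : 'I_(up_log b n)) (d : 'I_b) : {set 'I_n} := [set i | sigma i l != d].

Definition assort (n b : nat) (sigma : 'I_n -> {ffun 'I_(up_log b n) -> 'I_b})
  (a : option ('I_(up_log b n) * 'I_b)) : {set 'I_n} :=
  match a with None => [set: 'I_n] | Some (l, d) => design_set sigma l d end.

Definition prod_prob (R : realType) (I T : finType) (p : I -> T -> R)
  (E : pred {ffun I -> T}) : R :=
  \sum_(w : {ffun I -> T} | E w) \prod_(x : I) p x (w x).

Definition phihat (R : realType) (A T : finType) (m : nat)
  (w : {ffun A * 'I_m -> T}) (a : A) (o : T) : R :=
  (#|[set k : 'I_m | w (a, k) == o]|)%:R / m%:R.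

(* test statistic z with a = phihat(i,S), c = phihat(j,S), a' = phihat(i,[n]), c' = phihat(j,[n]) *)
Definition zstat (R : realType) (m : nat) (a c a' c' : R) : R :=
  (a / (a + c) - a' / (a' + c')) /
  Num.sqrt ((a + a') / (a + c + a' + c') * ((c + c') / (a + c + a' + c')) *
            ((m%:R)^-1 / (a + c) + (m%:R)^-1 / (a' + c'))).

(* Main.v *)
Require Import Defs.
From HB Require Import structures.
From mathcomp Require Import all_boot all_order all_algebra.
From mathcomp Require Import reals exp.
From mathcomp Require Import sequences ring lra.
Set Implicit Arguments. Unset Strict Implicit. Unset Printing Implicit Defensive.
Import Order.TTheory GRing.Theory Num.Theory.
Local Open Scope ring_scope.

(* Only single frequencies need to concentrate. A Chernoff bound with exponent
   [p e^2 / 4] and a union bound give, outside an event of probability at most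
   [delta], [(phihat - phi)^2 <= 4 l phi / m] for every assortment and every
   option in it, where [l = ln (2 K / delta)]. Regularity of the nested logit
   model, [phi S o >= phi [n] o >= rho], turns this into a relative error below
   1/10. The deviation of [ah / (ah + ch)] from [p = a / (a + c)] is then of order
   [sqrt (l p (1 - p) / (m (a + c)))], the same order as [sqrt l] times the
   denominator of [z]: so [|z| <= 8 sqrt (3 l)] when the two true ratios agree,
   while a gap [Delta] between them dominates both errors, with [C = 20]. *)

(** * Union and Markov bounds for finite product measures *)

Section ProductProbability.
Context (R : realType) (I T : finType) (p : I -> T -> R).
Hypothesis p_ge0 : forall x t, 0 <= p x t.
Hypothesis p_sum1 : forall x, \sum_t p x t = 1.

Lemma prod_prob_compl (E : pred {ffun I -> T}) :
  prod_prob p E = 1 - prod_prob p (predC E).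
Proof.
rewrite /prod_prob.
have : \sum_(w : {ffun I -> T}) \prod_x p x (w x) = 1.
  by rewrite -(bigA_distr_bigA (fun x t => p x t)) big1.
by rewrite (bigID E) /= => /(canRL (addrK _)) ->.
Qed.

Lemma prod_prob_union (J : finType) (Q : pred J)
    (F : pred {ffun I -> T}) (E : J -> pred {ffun I -> T}) :
  (forall w, F w -> exists2 j, Q j & E j w) ->
  prod_prob p F <= \sum_(j | Q j) prod_prob p (E j).
Proof.
move=> FE; rewrite /prod_prob.
under [leRHS]eq_bigr do rewrite big_mkcond.
rewrite exchange_big [leLHS]big_mkcond /=; apply: ler_sum => w _.
have pw0 : 0 <= \prod_x p x (w x) by apply: prodr_ge0.
case: ifP => [/FE[j Qj Ejw]|_]; last by apply: sumr_ge0 => j _; case: ifP.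
by rewrite (bigD1 j) //= Ejw lerDl; apply: sumr_ge0 => k _; case: ifP.
Qed.

(** Markov's inequality for a test function that is a product over coordinates: by independence its
    expectation factors into one-coordinate moments, which is the form an exponential-moment
    argument consumes. *)
Lemma prod_prob_markov (E : pred {ffun I -> T}) (g : I -> T -> R) :
  (forall x t, 0 <= g x t) -> (forall w, E w -> 1 <= \prod_x g x (w x)) ->
  prod_prob p E <= \prod_x \sum_t p x t * g x t.
Proof.
move=> g0 gE; rewrite bigA_distr_bigA /prod_prob [leLHS]big_mkcond /=.
apply: ler_sum => w _; rewrite big_split /=.
case: ifP => [/gE gw|_]; last by rewrite mulr_ge0 ?prodr_ge0.
by rewrite ler_peMr ?prodr_ge0.
Qed.

End ProductProbability.

(** * Multiplicative Chernoff bounds for one empirical frequency *)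

Section Chernoff.
Context (R : realType) (A T : finType) (m : nat) (p : A -> T -> R).
Hypothesis p_ge0 : forall a t, 0 <= p a t.
Hypothesis p_sum1 : forall a, \sum_t p a t = 1.
Hypothesis m_gt0 : (0 < m)%N.

Local Notation prob := (prod_prob (fun x : A * 'I_m => p x.1)).

(** Squaring [1 - x/2 <= exp(-x/2)] gives [(1 - x/2)^2 exp x <= 1]. It remains that [(1 - x/2)^2 (1
    + x + x^2) = 1 + x^2 (1 - 3x + x^2) / 4] is at least 1, which holds since [x <= 1/4]. *)
Lemma expR_le_quadratic (x : R) : `|x| <= 4^-1 -> expR x <= 1 + x + x ^+ 2.
Proof.
move=> /[!ler_norml] /andP[x1 x2].
have h : 1 - x / 2 <= expR (- (x / 2)) by apply: expR_ge1Dx.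
have h2 : (1 - x / 2) ^+ 2 * expR x <= 1.
  have e1 : expR (- (x / 2)) ^+ 2 * expR x = 1.
    rewrite -expRM_natl -expRD (_ : _ + _ = 0) ?expR0//; lra.
  rewrite -[leRHS]e1 ler_pM2r ?expR_gt0// ler_sqr ?nnegrE ?expR_ge0//; lra.
have q0 : 0 < (1 - x / 2) ^+ 2 by rewrite exprn_gt0//; lra.
rewrite -(ler_pM2l q0); apply: (le_trans h2).
nra.
Qed.

(* Exponential moments with parameter [e / 2]; the sign of [e] selects the
   upper or the lower tail. *)
Lemma chernoff_one_sided (a : A) (o : T) (e : R) : `|e| <= 2^-1 ->
  prob (fun w => 0 <= e * (phihat R w a o - p a o * (1 + e)))
    <= expR (- (m%:R * (p a o * e ^+ 2 / 4))).
Proof.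
move=> e_le.
have mR : 0 < m%:R :> R by rewrite ltr0n.
(* Only the [m] samples drawn from assortment [a] are tilted; the other coordinates contribute the
   factor 1. The product of [g] is then the exponential of [e/2] times the centred count, hence at
   least 1 on the event. *)
pose g (x : A * 'I_m) (t : T) : R :=
  if x.1 == a then expR (e / 2 * ((t == o)%:R - p a o * (1 + e))) else 1.
have gprod (f : A -> R) : \prod_(x : A * 'I_m) (if x.1 == a then f x.1 else 1) = f a ^+ m.
  rewrite -(pair_bigA _ (fun b (k : 'I_m) => if b == a then f b else 1)) /=.
  rewrite (bigD1 a) //= eqxx prodr_const card_ord big1 ?mulr1// => b /negbTE ->.
  by rewrite prodr_const expr1n.
apply: (le_trans (@prod_prob_markov _ _ _ _ _ _ g _ _)).
- by move=> x t; apply: p_ge0.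
- by move=> x t; rewrite /g; case: ifP => // _; apply: expR_ge0.
- move=> w /= Ew.
  rewrite (eq_bigr (fun x => g (x.1, x.2) (w (x.1, x.2)))); last by case.
  rewrite -(pair_bigA _ (fun b (k : 'I_m) => g (b, k) (w (b, k)))) /=.
  rewrite (bigD1 a) //= [X in _ * X]big1 ?mulr1; last first.
    by move=> b /negbTE ba; rewrite big1// => k _; rewrite /g /= ba.
  rewrite /g /= eqxx -expR_sum.
  apply: le_trans (expR_ge1Dx _); rewrite lerDl -mulr_sumr sumrB.
  rewrite sumr_const card_ord -natr_sum.
  have -> : (\sum_(k < m) (w (a, k) == o))%N = #|[set k : 'I_m | w (a, k) == o]|.
    rewrite -sum1_card [RHS]big_mkcond /=; apply: eq_bigr => k _.
    by rewrite inE; case: eqP.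
  have := mulr_ge0 (ltW mR) Ew; rewrite /phihat.
  set X := (#|_|)%:R; move=> h.
  have -> : e / 2 * (X - p a o * (1 + e) *+ m) = 2^-1 * (m%:R * (e * (X / m%:R - p a o * (1 + e)))).
    by rewrite -mulr_natr; field; rewrite gt_eqF.
  by rewrite mulr_ge0 ?invr_ge0.
have -> : \prod_(x : A * 'I_m) \sum_t p x.1 t * g x t =
   \prod_(x : A * 'I_m) (if x.1 == a then
        \sum_t p x.1 t * expR (e / 2 * ((t == o)%:R - p a o * (1 + e))) else 1).
  apply: eq_bigr => x _; rewrite /g; case: ifP => // _.
  by rewrite -[RHS](p_sum1 x.1); apply: eq_bigr => t _; rewrite mulr1.
rewrite (gprod (fun b => \sum_t p b t *
  expR (e / 2 * ((t == o)%:R - p a o * (1 + e))))).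
have -> : expR (- (m%:R * (p a o * e ^+ 2 / 4))) =
    expR (- (p a o * e ^+ 2 / 4)) ^+ m by rewrite -expRM_natl mulrN.
rewrite lerXn2r ?nnegrE ?expR_ge0//.
  by apply: sumr_ge0 => t _; rewrite mulr_ge0 ?expR_ge0.
under eq_bigr do rewrite mulrBr expRD mulrA.
rewrite -mulr_suml.
(* Moment generating function of the Bernoulli indicator of [o], at parameter [e/2]. *)
have -> : \sum_t p a t * expR (e / 2 * (t == o)%:R) = 1 + p a o * (expR (e / 2) - 1).
  have := p_sum1 a; rewrite (bigD1 o) //= => /(canRL (addKr _)) rest.
  rewrite (bigD1 o) //= eqxx mulr1 (eq_bigr (p a)); first by rewrite rest; ring.
  by move=> t /negbTE ->; rewrite mulr0 expR0 mulr1.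
have e2 : expR (e / 2) - 1 <= e / 2 + (e / 2) ^+ 2.
  rewrite lerBlDl addrA expR_le_quadratic//.
  by move: e_le; rewrite !ler_norml; lra.
have : 1 + p a o * (expR (e / 2) - 1) <= expR (p a o * (e / 2 + (e / 2) ^+ 2)).
  apply: le_trans (expR_ge1Dx _); rewrite lerD2l ler_wpM2l//.
move=> h; apply: (le_trans (ler_wpM2r (expR_ge0 _) h)).
(* The exponents add up to [p (e/2 + e^2/4) - p (e/2) (1 + e) = - p e^2 / 4]. *)
rewrite -expRD ler_expR; lra.
Qed.

(** With relative error [e = sqrt (t2 / p)] the exponent [p e^2 / 4] equals [t2 / 4], the same for
    every option, so a later union bound can treat all pairs alike. The condition [t2 <= p / 4] says
    [e <= 1/2], as the one-sided bound requires. *)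
Lemma chernoff_two_sided (a : A) (o : T) (t2 : R) :
  0 <= t2 -> 0 < p a o -> t2 <= p a o / 4 ->
  prob (fun w => ~~ ((phihat R w a o - p a o) ^+ 2 <= t2 * p a o))
    <= 2 * expR (- (m%:R * (t2 / 4))).
Proof.
move=> t20 pp t2p.
pose e := Num.sqrt (t2 / p a o).
have e0 : 0 <= e by apply: sqrtr_ge0.
have ee : e ^+ 2 = t2 / p a o by rewrite sqr_sqrtr// divr_ge0// ltW.
have pe : p a o * e ^+ 2 = t2 by rewrite ee mulrC divfK ?gt_eqF.
have e12 : e <= 2^-1.
  rewrite -ler_sqr ?nnegrE ?invr_ge0// ee ler_pdivrMr//; lra.
(* [s = false] is the upper tail and [s = true] the lower one, obtained by replacing [e] with
   [- e]. *)
pose E (s : bool) (w : {ffun A * 'I_m -> T}) :=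
  0 <= (-1) ^+ s * e * (phihat R w a o - p a o * (1 + (-1) ^+ s * e)).
apply: (le_trans (@prod_prob_union _ _ _ _ _ _ predT _ E _)).
- by move=> x t; apply: p_ge0.
- move=> w; rewrite -ltNge => hw.
  set d := phihat R w a o - p a o in hw.
  have [ed|] := leP (e * p a o) `|d|; last first.
    rewrite -ltr_sqr ?nnegrE ?mulr_ge0 ?(ltW pp)// real_normK ?num_real//.
    rewrite exprMn ee [_ ^+ 2 in X in _ < X -> _]expr2 mulrA divfK ?gt_eqF//.
    by move=> /(lt_trans hw); rewrite ltxx.
  exists (d < 0) => //; rewrite /E; move: ed; rewrite /d.
  case: ltP => hd; rewrite ?expr1 ?expr0 ?mul1r ?mulN1r; [rewrite ltr0_norm//|rewrite ger0_norm//]; nra.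
rewrite big_bool /= /E.
have [h1 h2] : `|e| <= 2^-1 /\ `|- e| <= 2^-1 by rewrite normrN ger0_norm.
have := chernoff_one_sided a o h1; have := chernoff_one_sided a o h2.
rewrite sqrrN pe expr1 expr0 mul1r mulN1r; lra.
Qed.

End Chernoff.

(** * Nested logit choice probabilities: a distribution, monotone under shrinking the assortment *)

Section Regularity.
Context (R : realType) (n : nat).
Context (P : {set {set 'I_n}}) (v : 'I_n -> R) (lam vN : {set 'I_n} -> R).
Hypothesis partP : partition P [set: 'I_n].
Hypothesis v_gt0 : forall i, 0 < v i.
Hypothesis lam01 : forall N, N \in P -> 0 <= lam N <= 1.
Hypothesis vN_gt0 : forall N, N \in P -> lam N = 0 -> 0 < vN N.

Local Notation weight := (nest_weight v lam vN).
Local Notation phi := (nl_phi P v lam vN).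

Lemma pblock_in_nests i : pblock P i \in P.
Proof. by apply: pblock_mem; rewrite (cover_partition partP) inE. Qed.

Lemma mem_own_nest i : i \in pblock P i.
Proof. by rewrite mem_pblock (cover_partition partP) inE. Qed.

Lemma sum_weights_gt0 (S : {set 'I_n}) : S != set0 -> 0 < \sum_(i in S) v i.
Proof.
case/set0Pn => i iS; rewrite (bigD1 i) //= ltr_pwDl//.
by apply: sumr_ge0 => j _; apply: ltW.
Qed.

Lemma sum_weights_ge0 (S : {set 'I_n}) : 0 <= \sum_(i in S) v i.
Proof. by apply: sumr_ge0 => j _; apply: ltW. Qed.

Lemma sum_weights_le (S S' : {set 'I_n}) : S \subset S' ->
  \sum_(i in S) v i <= \sum_(i in S') v i.
Proof.
move=> sSS'; rewrite [leRHS](big_setID S) /= (setIidPr sSS') lerDl.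
exact: sum_weights_ge0.
Qed.

Lemma lam_eq0 N : N \in P -> ~~ (0 < lam N) -> lam N = 0.
Proof. by move=> /lam01/andP[l0 _]; rewrite -leNgt => l1; apply/le_anti/andP. Qed.

Lemma nest_weight_ge0 N S : N \in P -> 0 <= weight N S.
Proof.
move=> NP; rewrite /nest_weight; case: ifPn => [_|/(lam_eq0 NP) l0].
  exact: powR_ge0.
by rewrite mulr_ge0 ?ler0n// ltW// vN_gt0.
Qed.

Lemma nest_weight_disjoint N S : N :&: S = set0 -> weight N S = 0.
Proof.
rewrite /nest_weight => ->; case: ifPn => [l0|_]; last by rewrite eqxx mulr0.
by rewrite big_set0 powR0// gt_eqF.
Qed.

Lemma nest_weight_le N (S S' : {set 'I_n}) : N \in P -> S \subset S' ->
  weight N S <= weight N S'.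
Proof.
move=> NP sSS'; rewrite /nest_weight; case: ifPn => [l0|/(lam_eq0 NP) l0].
  rewrite ge0_ler_powR ?nnegrE ?sum_weights_ge0 ?(ltW l0)//.
  by rewrite sum_weights_le// setIS.
rewrite ler_pM2l ?vN_gt0// ler_nat.
case: (eqVneq (N :&: S) set0) => //= /set0Pn[i]; rewrite inE => /andP[iN iS].
rewrite (_ : N :&: S' != set0)//; apply/set0Pn; exists i.
by rewrite inE iN (subsetP sSS').
Qed.

Lemma nl_denom_gt0 S : 0 < nl_denom P v lam vN S.
Proof. by rewrite ltr_pwDl// sumr_ge0// => N; apply: nest_weight_ge0. Qed.

Lemma nl_denom_le (S S' : {set 'I_n}) : S \subset S' ->
  nl_denom P v lam vN S <= nl_denom P v lam vN S'.
Proof.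
by move=> sSS'; rewrite lerD2l; apply: ler_sum => N NP; apply: nest_weight_le.
Qed.

(* [x `^ (lam N - 1)] is antitone in [x], because [lam N <= 1]. *)
Lemma nest_weight_ratio_anti N (S S' : {set 'I_n}) : N \in P -> S \subset S' ->
  N :&: S != set0 ->
  weight N S' / (\sum_(j in N :&: S') v j) <= weight N S / (\sum_(j in N :&: S) v j).
Proof.
move=> NP sSS' NS0; have /andP[_ l1] := lam01 NP.
have XY := sum_weights_le (setIS N sSS').
have X0 := sum_weights_gt0 NS0.
have Y0 := lt_le_trans X0 XY.
have NS'0 : N :&: S' != set0 by apply: subset_neq0 NS0; apply: setIS.
rewrite /nest_weight NS0 NS'0.
set X := \sum_(j in N :&: S) v j in X0 XY *.
set Y := \sum_(j in N :&: S') v j in Y0 XY *.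
case: ifPn => [l0|/(lam_eq0 NP) l0]; last first.
  by rewrite ler_pM2l ?mulr1 ?vN_gt0// lef_pV2.
rewrite ler_pdivrMr// mulrAC ler_pdivlMr//.
(* After cross-multiplication the claim reads [Y^lam X <= X^lam Y]; splitting the plain factors
   cancels [X^lam Y^lam] and leaves [X^(1 - lam) <= Y^(1 - lam)]. *)
have split x : 0 < x -> x = x `^ lam N * x `^ (1 - lam N).
  move=> x0; rewrite -powRD ?(gt_eqF x0) ?implybT//.
  by rewrite addrC subrK powRr1// ltW.
rewrite [X in _ * X <= _](split X X0) [X in _ <= _ * X](split Y Y0).
rewrite mulrCA ler_wpM2l ?powR_ge0// ler_wpM2l ?powR_ge0//.
by rewrite ge0_ler_powR ?nnegrE ?subr_ge0 ?(ltW X0) ?(ltW Y0).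
Qed.

Lemma nl_phi_ge0 S o : 0 <= phi S o.
Proof.
case: o => [i|] /=; last by rewrite divr_ge0// ltW// nl_denom_gt0.
case: ifP => // _; rewrite !(mulr_ge0, invr_ge0) ?sum_weights_ge0//.
- by rewrite nest_weight_ge0 ?pblock_in_nests.
- by rewrite ltW// nl_denom_gt0.
- exact: ltW.
Qed.

(** Regroup the probability of an item as (nest weight / in-nest sum) times ([v i] / denominator).
    Passing to a smaller assortment raises the first factor by [nest_weight_ratio_anti] and the
    second because the denominator shrinks. *)
Lemma nl_phi_regular (S S' : {set 'I_n}) o : S \subset S' -> opt_in S o -> phi S' o <= phi S o.
Proof.
move=> sSS'; have d1 := nl_denom_gt0 S; have d2 := nl_denom_gt0 S'.
have d12 := nl_denom_le sSS'.
case: o => [i|] /=; last by rewrite !div1r lef_pV2.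
move=> iS; rewrite iS (subsetP sSS')//.
set N := pblock P i.
have NS0 : N :&: S != set0 by apply/set0Pn; exists i; rewrite inE mem_own_nest.
have NP := pblock_in_nests i.
have h := nest_weight_ratio_anti NP sSS' NS0.
have re (w d x y : R) : w / d * (x / y) = (w / y) * (x / d) by ring.
rewrite [leLHS]re [leRHS]re; apply: ler_pM => //.
- by rewrite divr_ge0 ?nest_weight_ge0 ?sum_weights_ge0.
- by rewrite divr_ge0// ltW.
- by rewrite ler_pM2l ?lef_pV2.
Qed.

Lemma nl_phi_sum1 S : \sum_o phi S o = 1.
Proof.
have d0 := nl_denom_gt0 S.
rewrite (bigD1 None) //= (reindex_omap some id) /=; last by case.
under eq_bigl do rewrite eqxx.
have -> : \sum_(i : 'I_n | true) (if i \in S then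
    weight (pblock P i) S / nl_denom P v lam vN S *
      (v i / \sum_(j in pblock P i :&: S) v j) else 0) =
    \sum_(N in P) weight N S / nl_denom P v lam vN S.
  rewrite (eq_bigl (fun i => i \in cover P)); last first.
    by move=> i; rewrite (cover_partition partP) inE.
  rewrite big_trivIset ?(partition_trivIset partP)//; apply: eq_bigr => N NP.
  rewrite (eq_bigr (fun i => if i \in S then weight N S / nl_denom P v lam vN S *
      (v i / \sum_(j in N :&: S) v j) else 0)); last first.
    by move=> i iN; rewrite (def_pblock (partition_trivIset partP) NP iN).
  rewrite -big_mkcondr /= -mulr_sumr -mulr_suml.
  rewrite (eq_bigl (fun i => i \in N :&: S)); last by move=> i; rewrite inE.
  (* Within a nest that meets [S] the conditional shares sum to 1; a nest that misses [S] has weight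
     0, so the degenerate quotient there is harmless. *)
  have [NS0|/sum_weights_gt0 NS0] := eqVneq (N :&: S) set0.
    by rewrite (nest_weight_disjoint NS0) !mul0r.
  by rewrite divff ?mulr1// gt_eqF.
by rewrite -mulr_suml -mulrDl divff// gt_eqF.
Qed.
End Regularity.

(** * Deterministic error bounds for the ratio of two perturbed frequencies *)

Lemma ratio_deviation (R : realFieldType) (t2 a c ah ch : R) :
  0 < a -> 0 < c -> 0 <= t2 ->
  (ah - a) ^+ 2 <= t2 * a -> (ch - c) ^+ 2 <= t2 * c ->
  9 / 10 * a <= ah -> 9 / 10 * c <= ch ->
  (ah / (ah + ch) - a / (a + c)) ^+ 2
    <= 20 / 9 * t2 * (a / (a + c) * (c / (a + c))) / (ah + ch).
Proof.
move=> a0 c0 t0 ha hc la lc.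
have s0 : 0 < a + c by lra.
have sh0 : 0 < ah + ch by lra.
have -> : ah / (ah + ch) - a / (a + c) =
    (c * (ah - a) - a * (ch - c)) / ((a + c) * (ah + ch)).
  by field; rewrite !gt_eqF.
(* By [(u - v)^2 <= 2 u^2 + 2 v^2], without any relation between the two errors. One factor [a + c]
   is later traded for [10/9 (ah + ch)], whence the constant 20/9; keeping [ah + ch] matches the
   denominator of [zstat]. *)
have h1 : (c * (ah - a) - a * (ch - c)) ^+ 2 <= 2 * t2 * (a * c) * (a + c).
  apply: (@le_trans _ _ (2 * (c ^+ 2 * (ah - a) ^+ 2 + a ^+ 2 * (ch - c) ^+ 2))).
    have := sqr_ge0 (c * (ah - a) + a * (ch - c)); lra.
  have := ler_wpM2l (sqr_ge0 c) ha; have := ler_wpM2l (sqr_ge0 a) hc; lra.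
rewrite expr_div_n ler_pdivrMr ?exprn_gt0 ?mulr_gt0//.
apply: (le_trans h1).
have -> : 20 / 9 * t2 * (a / (a + c) * (c / (a + c))) / (ah + ch)
    * ((a + c) * (ah + ch)) ^+ 2 = 20 / 9 * t2 * (a * c) * (ah + ch).
  by field; rewrite !gt_eqF.
have tac : 0 <= t2 * (a * c) by rewrite !mulr_ge0// ltW.
have : t2 * (a * c) * (9 / 10 * (a + c)) <= t2 * (a * c) * (ah + ch).
  by rewrite ler_wpM2l//; lra.
lra.
Qed.

Lemma compl_ratio (R : realFieldType) (x y : R) : 0 < x + y ->
  y / (x + y) = 1 - x / (x + y).
Proof. by move=> s0; field; rewrite gt_eqF. Qed.

Lemma ratio_compl_le (R : realFieldType) (x : R) : x * (1 - x) <= 4^-1.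
Proof. have := sqr_ge0 (x - 2^-1); lra. Qed.

Lemma inv_sum_le (R : realFieldType) (rho x y xh yh : R) :
  0 < rho -> rho <= x -> rho <= y -> 9 / 10 * x <= xh -> 9 / 10 * y <= yh ->
  (xh + yh)^-1 <= (9 / 5 * rho)^-1.
Proof. by move=> *; rewrite lef_pV2 ?posrE; lra. Qed.

Lemma ratio_deviation_le (R : realFieldType) (rho D t2 a c ah ch : R) :
  0 < rho -> 0 < D -> rho <= a -> rho <= c -> 0 <= t2 ->
  t2 <= rho * D ^+ 2 / 300 ->
  (ah - a) ^+ 2 <= t2 * a -> (ch - c) ^+ 2 <= t2 * c ->
  9 / 10 * a <= ah -> 9 / 10 * c <= ch ->
  `|ah / (ah + ch) - a / (a + c)| <= D / 16.
Proof.
move=> r0 D0 ra rc t0 t2le da dc la lc.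
have a0 := lt_le_trans r0 ra; have c0 := lt_le_trans r0 rc.
have s0 : 0 < a + c by rewrite addr_gt0.
have := ratio_deviation a0 c0 t0 da dc la lc.
rewrite (compl_ratio s0) => d.
have D16 : 0 <= D / 16 by lra.
rewrite -ler_sqr ?nnegrE// real_normK ?num_real//; apply: (le_trans d).
(* Here [p (1 - p) <= 1/4] and [ah + ch >= 9/5 rho]; the product is [25/81 t2 / rho <= D^2 / 972],
   below [(D / 16)^2]. *)
apply: (@le_trans _ _ (20 / 9 * t2 * 4^-1 * (9 / 5 * rho)^-1)).
  apply: ler_pM.
  - rewrite mulr_ge0//; first by lra.
    by rewrite -compl_ratio// mulr_ge0// divr_ge0// ltW.
  - by rewrite invr_ge0; lra.
  - by rewrite ler_wpM2l ?ratio_compl_le//; lra.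
  - exact: inv_sum_le ra rc la lc.
rewrite ler_pdivrMr; last by lra.
have : 0 <= rho * D ^+ 2 by rewrite mulr_ge0 ?sqr_ge0// ltW.
lra.
Qed.

Lemma norm_div_sqrt_le (R : rcfType) (N D x : R) : 0 < D -> 0 <= x ->
  (`|N / Num.sqrt D| <= 8 * Num.sqrt x) = (N ^+ 2 <= 64 * x * D).
Proof.
move=> D0 x0; have sD : 0 < Num.sqrt D by rewrite sqrtr_gt0.
rewrite normrM normfV (gtr0_norm sD) ler_pdivrMr//.
rewrite -ler_sqr ?nnegrE ?mulr_ge0 ?sqrtr_ge0// real_normK ?num_real//.
by rewrite !exprMn !sqr_sqrtr ?(ltW D0)// -natrX.
Qed.

Lemma deviation_bounds (R : realFieldType) (t2 a ah : R) :
  0 < a -> t2 <= a / 100 -> (ah - a) ^+ 2 <= t2 * a ->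
  9 / 10 * a <= ah <= 11 / 10 * a.
Proof.
move=> a0 ta h.
have : (ah - a) ^+ 2 <= (a / 10) ^+ 2.
  by apply: (le_trans h); have := ler_wpM2r (ltW a0) ta; lra.
rewrite -[leLHS]real_normK ?num_real// ler_sqr ?nnegrE//; last by lra.
rewrite ler_norml; lra.
Qed.

(** * The two sides of the threshold for the test statistic *)

Section Zstat.
Context (R : realType) (m : nat) (l rho Delta : R).
Context (a c a' c' ah ch ah' ch' : R).
Hypotheses (m_gt0 : (0 < m)%N) (l_gt0 : 0 < l) (rho_gt0 : 0 < rho).
Hypotheses (Delta_gt0 : 0 < Delta) (Delta_lt1 : Delta < 1).
Hypothesis l_le : l / m%:R <= rho * Delta ^+ 2 / 1200.
Hypotheses (a_ge : rho <= a) (c_ge : rho <= c).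
Hypotheses (a'_ge : rho <= a') (c'_ge : rho <= c').
Local Notation t2 := (4 * (l / m%:R)).
Hypothesis ah_dev : (ah - a) ^+ 2 <= t2 * a.
Hypothesis ch_dev : (ch - c) ^+ 2 <= t2 * c.
Hypothesis ah'_dev : (ah' - a') ^+ 2 <= t2 * a'.
Hypothesis ch'_dev : (ch' - c') ^+ 2 <= t2 * c'.

Lemma rate_gt0 : 0 < l / m%:R.
Proof. by rewrite divr_gt0// ltr0n. Qed.

Lemma empirical_bounds (x xh : R) : rho <= x -> (xh - x) ^+ 2 <= t2 * x ->
  9 / 10 * x <= xh <= 11 / 10 * x.
Proof.
move: (rho_gt0) (l_le) => r0 lle rx; apply: deviation_bounds; first exact: lt_le_trans rx.
apply: (@le_trans _ _ (rho / 100)); last by lra.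
have : rho * Delta ^+ 2 <= rho * 1.
  by rewrite ler_pM2l// exprn_ile1// ltW.
lra.
Qed.

Local Notation pooled := ((ah + ah') / (ah + ch + ah' + ch') *
  ((ch + ch') / (ah + ch + ah' + ch'))).
Local Notation invs := ((ah + ch)^-1 + (ah' + ch')^-1).

(** Common reduction for both directions: squaring gives [64 * 3 = 192], and the factor [1/m] inside
    the root of [zstat] joins [l]. The frequencies are positive by the relative error bounds, so the
    root is nonzero. *)
Lemma zstat_le_sq : (`|zstat m ah ch ah' ch'| <= 8 * Num.sqrt (3 * l)) =
  ((ah / (ah + ch) - ah' / (ah' + ch')) ^+ 2 <=
     192 * (l / m%:R) * (pooled * invs)).
Proof.
move: (rho_gt0) (l_le) (Delta_gt0) (a_ge) (c_ge) (a'_ge) (c'_ge).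
move=> r0 lle Dp ra rc ra' rc'.
have lp := l_gt0.
have /andP[? _] := empirical_bounds a_ge ah_dev; have /andP[? _] := empirical_bounds c_ge ch_dev.
have /andP[? _] := empirical_bounds a'_ge ah'_dev; have /andP[? _] := empirical_bounds c'_ge ch'_dev.
have mR : 0 < m%:R :> R by rewrite ltr0n.
rewrite /zstat norm_div_sqrt_le; last by lra.
  congr (_ <= _); rewrite -!mulrA -!mulrDr; field.
  by rewrite !gt_eqF//; lra.
by rewrite !(mulr_gt0, addr_gt0, invr_gt0)//; lra.
Qed.

Lemma zstat_small : a / (a + c) = a' / (a' + c') ->
  `|zstat m ah ch ah' ch'| <= 8 * Num.sqrt (3 * l).
Proof.
rewrite zstat_le_sq => eqp.
move: (rho_gt0) (l_le) (Delta_gt0) (a_ge) (c_ge) (a'_ge) (c'_ge).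
move=> r0 lle Dp ra rc ra' rc'.
have /andP[la ua] := empirical_bounds a_ge ah_dev; have /andP[lc uc] := empirical_bounds c_ge ch_dev.
have /andP[la' ua'] := empirical_bounds a'_ge ah'_dev; have /andP[lc' uc'] := empirical_bounds c'_ge ch'_dev.
have h0 := rate_gt0; have t20 : 0 <= t2 by lra.
have d1 := @ratio_deviation _ t2 a c ah ch ltac:(lra) ltac:(lra) t20 ah_dev ch_dev la lc.
have d2 := @ratio_deviation _ t2 a' c' ah' ch' ltac:(lra) ltac:(lra) t20 ah'_dev ch'_dev la' lc'.
set p := a / (a + c) in eqp d1.
have cq x y : rho <= x -> rho <= y -> y / (x + y) = 1 - x / (x + y).
  by move=> ? ?; field; rewrite gt_eqF//; lra.
rewrite (cq a c)// -/p in d1; rewrite (cq a' c')// -eqp in d2.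
have ap : a = p * (a + c) by rewrite /p; field; rewrite gt_eqF//; lra.
have ap' : a' = p * (a' + c') by rewrite eqp; field; rewrite gt_eqF//; lra.
have p0 : 0 < p by rewrite /p divr_gt0//; lra.
have p1 : 0 < 1 - p by rewrite -cq// divr_gt0//; lra.
have sh0 : 0 < ah + ch + ah' + ch' by lra.
(* Both true ratios equal [p], so the pooled one estimates [p]: its numerator loses at most a factor
   9/10 and its denominator gains at most 11/10. *)
have P1 : 9 / 11 * p <= (ah + ah') / (ah + ch + ah' + ch').
  rewrite ler_pdivlMr//.
  have : p * (ah + ch + ah' + ch') <= p * (11 / 10 * (a + c + (a' + c'))).
    by rewrite ler_pM2l//; lra.
  lra.
have P2 : 9 / 11 * (1 - p) <= (ch + ch') / (ah + ch + ah' + ch').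
  rewrite ler_pdivlMr//.
  have : (1 - p) * (ah + ch + ah' + ch') <= (1 - p) * (11 / 10 * (a + c + (a' + c'))).
    by rewrite ler_pM2l//; lra.
  lra.
have PP : 81 / 121 * (p * (1 - p)) <= pooled.
  apply: (@le_trans _ _ ((9 / 11 * p) * (9 / 11 * (1 - p)))); first by lra.
  by apply: ler_pM => //; lra.
set x := ah / _ in d1 *; set y := ah' / _ in d2 *.
have xy : (x - y) ^+ 2 <= 2 * (x - p) ^+ 2 + 2 * (y - p) ^+ 2.
  have := sqr_ge0 ((x - p) + (y - p)); lra.
have i0 : 0 < invs by rewrite addr_gt0// invr_gt0; lra.
have H := ler_wpM2r (ltW i0) PP.
have H2 := ler_wpM2l (ltW h0) H.
have H3 : 0 <= (l / m%:R) * (p * (1 - p) * invs).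
  exact: mulr_ge0 (ltW h0) (mulr_ge0 (mulr_ge0 (ltW p0) (ltW p1)) (ltW i0)).
apply: (le_trans xy).
(* In units of [(l/m) p (1 - p) invs], the left side is at most [2 * 20/9 * 4 = 160/9] and the right
   side at least [192 * 81/121]. *)
move: H2; move: (pooled * invs) => Z H2; move: (l / m%:R) H2 H3 d1 d2 => h; lra.
Qed.

Lemma zstat_large : Delta <= `|a / (a + c) - a' / (a' + c')| ->
  8 * Num.sqrt (3 * l) < `|zstat m ah ch ah' ch'|.
Proof.
move=> gap; rewrite ltNge zstat_le_sq -ltNge.
move: (rho_gt0) (l_le) (Delta_gt0) (a_ge) (c_ge) (a'_ge) (c'_ge).
move=> r0 lle Dp ra rc ra' rc'.
have /andP[la ua] := empirical_bounds a_ge ah_dev; have /andP[lc uc] := empirical_bounds c_ge ch_dev.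
have /andP[la' ua'] := empirical_bounds a'_ge ah'_dev; have /andP[lc' uc'] := empirical_bounds c'_ge ch'_dev.
have h0 := rate_gt0; have t20 : 0 <= t2 by lra.
have t2le : t2 <= rho * Delta ^+ 2 / 300 by lra.
have e1 := ratio_deviation_le r0 Dp ra rc t20 t2le ah_dev ch_dev la lc.
have e2 := ratio_deviation_le r0 Dp ra' rc' t20 t2le ah'_dev ch'_dev la' lc'.
set x := ah / _ in e1 *; set y := ah' / _ in e2 *.
(* The gap [Delta] loses at most [Delta / 16] at each of the two empirical ratios. *)
have xy : 7 / 8 * Delta <= `|x - y|.
  move: gap e1 e2; set p := a / _; set q := a' / _ => gap e1 e2.
  have := ler_distD x p q; have := ler_distD y x q.
  rewrite (distrC p x); lra.
have xy2 : 49 / 64 * Delta ^+ 2 <= (x - y) ^+ 2.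
  rewrite -[leRHS]real_normK ?num_real//.
  have : (7 / 8 * Delta) ^+ 2 <= `|x - y| ^+ 2 by rewrite ler_sqr ?nnegrE//; lra.
  lra.
apply: lt_le_trans xy2.
(* The pooled product is at most 1/4 and each inverse at most [1 / (9/5 rho)]. With the bound on
   [l/m] this is at most [2/45 Delta^2], well under [49/64 Delta^2]. *)
apply: (@le_lt_trans _ _ (192 * (l / m%:R) * (4^-1 * (2 * (9 / 5 * rho)^-1)))).
  rewrite ler_pM2l; last by lra.
  apply: ler_pM.
  - by rewrite !(mulr_ge0, invr_ge0)//; lra.
  - by rewrite addr_ge0// invr_ge0; lra.
  - have -> : ah + ch + ah' + ch' = (ah + ah') + (ch + ch') by ring.
    rewrite (@compl_ratio _ (ah + ah')); first exact: ratio_compl_le.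
    by lra.
  - rewrite mulr_natl mulr2n.
    exact: lerD (inv_sum_le r0 ra rc la lc) (inv_sum_le r0 ra' rc' la' lc').
have -> : 192 * (l / m%:R) * (4^-1 * (2 * (9 / 5 * rho)^-1)) = (160 / 3 * (l / m%:R)) / rho.
  by field; rewrite !gt_eqF ?ltr0n.
rewrite ltr_pdivrMr//.
have : 0 < rho * Delta ^+ 2 by rewrite mulr_gt0 ?exprn_gt0//; lra.
lra.
Qed.
End Zstat.

(** * From boost factors to ratios, and the union bound *)

Lemma ratio_eq_of_boost_eq (R : realFieldType) (a c a' c' : R) :
  0 < a -> 0 < c -> 0 < a' -> 0 < c' -> a / a' = c / c' ->
  a / (a + c) = a' / (a' + c').
Proof.
move=> a0 c0 a'0 c'0 /eqP; rewrite eqr_div ?lt0r_neq0// => /eqP ac.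
apply/eqP; rewrite eqr_div ?lt0r_neq0 ?addr_gt0//; apply/eqP; lra.
Qed.

Theorem theorem4p6 (R : realType) :
  exists C : R,
  forall (n b : nat) (sigma : 'I_n -> {ffun 'I_(up_log b n) -> 'I_b})
    (P : {set {set 'I_n}}) (v : 'I_n -> R) (lam vN : {set 'I_n} -> R)
    (m : nat) (rho Delta delta : R),
  (2 <= n)%N -> (2 <= b)%N -> injective sigma ->
  partition P [set: 'I_n] ->
  (forall i, 0 < v i) ->
  (forall N, N \in P -> 0 <= lam N <= 1) ->
  (forall N, N \in P -> lam N = 0 -> 0 < vN N) ->
  0 < rho < 1 -> 0 < Delta < 1 -> 0 < delta < 1 ->
  (forall o : option 'I_n, rho <= nl_phi P v lam vN [set: 'I_n] o) ->
  (forall (l : 'I_(up_log b n)) (d : 'I_b) (o1 o2 : option 'I_n),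
     let S := design_set sigma l d in
     opt_in S o1 -> opt_in S o2 ->
     nl_BF P v lam vN S o1 != nl_BF P v lam vN S o2 ->
     Delta <= `| nl_phi P v lam vN S o1 /
                   (nl_phi P v lam vN S o1 + nl_phi P v lam vN S o2)
               - nl_phi P v lam vN [set: 'I_n] o1 /
                   (nl_phi P v lam vN [set: 'I_n] o1
                    + nl_phi P v lam vN [set: 'I_n] o2) |) ->
  let K : R := ((up_log b n * b).+1 * (n.+1 + 'C(n.+1, 2)))%:R in
  3 * C ^+ 2 * ln (2 * K / delta) / (rho * Delta ^+ 2) <= m%:R ->
  1 - delta <=
  prod_prob
    (fun x : option ('I_(up_log b n) * 'I_b) * 'I_m =>
       nl_phi P v lam vN (assort sigma x.1))
    (fun w =>
       [forall l : 'I_(up_log b n), forall d : 'I_b,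
        forall o1 : option 'I_n, forall o2 : option 'I_n,
        (opt_in (design_set sigma l d) o1 && opt_in (design_set sigma l d) o2) ==>
        ((`| zstat m (phihat R w (Some (l, d)) o1) (phihat R w (Some (l, d)) o2)
                     (phihat R w None o1) (phihat R w None o2) |
            <= 8 * Num.sqrt (3 * ln (2 * K / delta)))
         == (nl_BF P v lam vN (design_set sigma l d) o1
             == nl_BF P v lam vN (design_set sigma l d) o2))]).
Proof.
(* [3 * 20^2 = 1200] is the constant in the bound on [l / m] assumed by the threshold lemmas. *)
exists 20 => n b sigma P v lam vN m rho Delta delta n2 b2 _ partP v0 lam01 vN0.
move=> /andP[r0 r1] /andP[D0 D1] /andP[d0 d1] rho_le gap K m_ge.
set l := ln (2 * K / delta) in m_ge *.
have K1 : 1 <= K.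
  by rewrite /K ler1n muln_gt0/= addn_gt0.
have Kd1 : 1 < 2 * K / delta by rewrite ltr_pdivlMr//; lra.
have l0 : 0 < l by rewrite ln_gt0.
have rD0 : 0 < rho * Delta ^+ 2 by rewrite mulr_gt0 ?exprn_gt0.
have mR : 0 < m%:R :> R.
  apply: lt_le_trans m_ge; rewrite divr_gt0// mulr_gt0//.
  by rewrite mulr_gt0 ?exprn_gt0.
have m0 : (0 < m)%N by rewrite -(ltr0n R).
have h_le : l / m%:R <= rho * Delta ^+ 2 / 1200.
  move: m_ge; rewrite !ler_pdivrMr//; lra.
have h0 : 0 < l / m%:R by rewrite divr_gt0.
have phi_ge0 := nl_phi_ge0 partP v0 lam01 vN0.
have phi_sum1 := nl_phi_sum1 partP v0 lam01 vN0.
have phi_ge S o : opt_in S o -> rho <= nl_phi P v lam vN S o.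
  by move=> oS; apply: le_trans (rho_le o) _; apply: nl_phi_regular.
pose A := option ('I_(up_log b n) * 'I_b).
pose p (a : A) := nl_phi P v lam vN (assort sigma a).
pose t2 := 4 * (l / m%:R).
rewrite (prod_prob_compl (p := fun x : A * 'I_m => p x.1)); last first.
  by move=> x; apply: phi_sum1.
rewrite lerD2l lerN2.
(* Failure events are indexed by (assortment, option) pairs, the control assortment [None] included.
   When none occurs, the equivalence for every pair of options follows deterministically. *)
pose bad (j : A * option 'I_n) (w : {ffun A * 'I_m -> option 'I_n}) :=
  ~~ ((phihat R w j.1 j.2 - p j.1 j.2) ^+ 2 <= t2 * p j.1 j.2).
pose Q (j : A * option 'I_n) := opt_in (assort sigma j.1) j.2.
apply: (@le_trans _ _ (\sum_(j | Q j) prod_prob (fun x : A * 'I_m => p x.1) (bad j))).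
  apply: prod_prob_union => [x t|w]; first exact: phi_ge0.
  case: (pickP (fun j => Q j && bad j w)) => [j /andP[Qj bj] _|nobad].
    by exists j.
  case/negP.
  have good a o : opt_in (assort sigma a) o ->
      (phihat R w a o - p a o) ^+ 2 <= t2 * p a o.
    by move=> oa; have := nobad (a, o); rewrite /Q /bad/= oa => /negbFE.
  apply/forallP => i; apply/forallP => d; apply/forallP => o1; apply/forallP => o2.
  apply/implyP => /andP[o1S o2S].
  have T o : opt_in (assort sigma None) o by case: o => //= x; rewrite inE.
  have g1 := good (Some (i, d)) o1 o1S; have g2 := good (Some (i, d)) o2 o2S.
  have g3 := good None o1 (T o1); have g4 := good None o2 (T o2).
  have p1 := phi_ge _ _ o1S; have p2 := phi_ge _ _ o2S.
  have p3 := phi_ge _ _ (T o1); have p4 := phi_ge _ _ (T o2).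
  set S := design_set sigma i d.
  case: (eqVneq (nl_BF P v lam vN S o1) (nl_BF P v lam vN S o2)) => [BFeq|BFneq].
    rewrite eqb_id; apply: (zstat_small m0 l0 r0 D0 D1 h_le p1 p2 p3 p4 g1 g2 g3 g4).
    by apply: ratio_eq_of_boost_eq BFeq; apply: lt_le_trans r0 _.
  rewrite eqbF_neg -ltNge.
  apply: (zstat_large m0 l0 r0 D0 D1 h_le p1 p2 p3 p4 g1 g2 g3 g4).
  exact: gap.
have badle j : Q j -> prod_prob (fun x : A * 'I_m => p x.1) (bad j) <= delta / K.
  move=> Qj; have pj := phi_ge _ _ Qj.
  have pj0 : 0 < p j.1 j.2 by apply: lt_le_trans pj.
  have t2p : t2 <= p j.1 j.2 / 4.
    apply: (@le_trans _ _ (rho / 4)); last by rewrite ler_pM2r// invr_gt0.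
    have : rho * Delta ^+ 2 <= rho * 1 by rewrite ler_pM2l// exprn_ile1// ltW.
    rewrite /t2; lra.
  have t20 : 0 <= t2 by rewrite /t2; lra.
  have p_ge0 a o : 0 <= p a o by apply: phi_ge0.
  have p_sum1 a : \sum_o p a o = 1 by apply: phi_sum1.
  apply: le_trans (chernoff_two_sided p_ge0 p_sum1 m0 t20 pj0 t2p) _.
  (* The factor 4 in [t2] makes the Chernoff exponent exactly [l], and [2 exp(- l) = delta / K]. *)
  have -> : m%:R * (t2 / 4) = l by rewrite /t2; field; rewrite gt_eqF.
  rewrite expRN lnK ?posrE ?(lt_trans ltr01)// invf_div mulrA.
  have K0 : K != 0 by rewrite gt_eqF// (lt_le_trans ltr01).
  have cancel2 (k : R) : k != 0 -> 2 * delta / (2 * k) = delta / k.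
    by move=> k0; field.
  by rewrite cancel2.
apply: (le_trans (ler_sum _ badle)).
rewrite sumr_const -mulr_natr mulrAC ler_pdivrMr; last exact: lt_le_trans K1.
rewrite ler_pM2l// /K ler_nat.
(* There are at most [(L b + 1) (n + 1)] pairs, which is bounded by [K]. *)
apply: (leq_trans (max_card _)).
rewrite card_prod !card_option card_prod !card_ord leq_mul2l leq_addr.
by rewrite orbT.
Qed.
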